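(* Let $\{x_k\}_{k\ge -1}$, with gradients $g_k=g(x_k)$, be a post-warm-up tail (as defined in the context) whose steps $\alpha_k$, $k\ge 0$, are all given by the BB1 rule or all given by the BB2 rule, let $a<b$ be the endpoints of $\Lambda=\Lambda(g_{-1})$, and let $\tau_k=1/\alpha_k$. Then for every $k\ge 0$, $$\overline f(x_{k+1})=\left(\frac{\tau_k-a}{\tau_k}\right)^{\frac{2b}{a+b}}\left(\frac{b-\tau_k}{\tau_k}\right)^{\frac{2a}{a+b}}\overline f(x_k)=c_{a,b}^{\,2}\,e^{-2D_{a,b}(\tau_k)}\,\overline f(x_k).$$ Consequently, $$0<\overline f(x_{k+1})\le c_{a,b}^{\,2}\,\overline f(x_k)<\overline f(x_k)\qquad(k\ge 0).$$ The same statements hold when the steps $\alpha_k$, $k\ge 0$, are given by any fixed positive weighted delayed rule $$\alpha_k^{\Psi}=\frac{g_{k-1}^{\mathsf T}\Psi(H)g_{k-1}}{g_{k-1}^{\mathsf T}\Psi(H)Hg_{k-1}},\qquad \Psi(\lambda)>0\ \ (\lambda\in\Lambda).$$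
   Context: Setting. $H\in\mathbb{R}^{d\times d}$ is symmetric positive definite, $q\in\mathbb{R}^d$, $f(x)=\frac12 x^{\mathsf T}Hx-q^{\mathsf T}x$, $x_*=H^{-1}q$, and $g(x)=\nabla f(x)=H(x-x_* )$. $\|\cdot\|$ is the Euclidean norm. For $\lambda\in\operatorname{spec}(H)$ (the set of distinct eigenvalues), $P_\lambda$ is the orthogonal projector onto the eigenspace of $\lambda$. For a nonzero vector $v$, $\Lambda(v)=\{\lambda\in\operatorname{spec}(H):P_\lambda v\neq 0\}$. $\Psi(H)=\sum_\lambda \Psi(\lambda)P_\lambda$. Post-warm-up tail. A sequence $\{x_k\}_{k\ge -1}$ with $g_k=g(x_k)$ such that: $x_0=x_{-1}-\hat\alpha g_{-1}$ for some real $\hat\alpha$ (the warm-up step), so $g_0=(I-\hat\alpha H)g_{-1}$; the set $\Lambda:=\Lambda(g_{-1})$ has $|\Lambda|\ge 2$; with $a:=\min\Lambda$ and $b:=\max\Lambda$ (so $0<a<b$) one has $P_ag_j\neq 0$ and $P_bg_j\ne 0$ for $j=-1,0$; and for every $k\ge 0$, $x_{k+1}=x_k-\alpha_kg_k$, so $g_{k+1}=(I-\alpha_kH)g_k$, where $\alpha_k$ is given by the chosen delayed rule: BB1: $\alpha_k=\dfrac{g_{k-1}^{\mathsf T}g_{k-1}}{g_{k-1}^{\mathsf T}Hg_{k-1}}$; BB2: $\alpha_k=\dfrac{g_{k-1}^{\mathsf T}Hg_{k-1}}{g_{k-1}^{\mathsf T}H^2g_{k-1}}$; or the weighted rule with a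 fixed function $\Psi$ positive on $\Lambda$. Endpoint quantities. $$\overline f(x)=\|P_ag(x)\|^{\frac{2b}{a+b}}\|P_bg(x)\|^{\frac{2a}{a+b}},\qquad c_{a,b}=\frac{b-a}{b+a},$$ and for $u\in(a,b)$, $$D_{a,b}(u)=\log c_{a,b}-\frac{b}{a+b}\log\frac{u-a}{u}-\frac{a}{a+b}\log\frac{b-u}{u}.$$ *)

(* Defs.v *)
From HB Require Import structures.
From mathcomp Require Import all_boot all_order all_algebra finmap ring.
From mathcomp Require Import all_classical all_reals all_analysis.

Set Implicit Arguments.
Unset Strict Implicit.
Unset Printing Implicit Defensive.

Import Order.TTheory GRing.Theory Num.Theory.
Import numFieldNormedType.Exports.

Local Open Scope classical_set_scope.
Local Open Scope ring_scope.

Definition dotv (R : realType) (d : nat) (u v : 'cV[R]_d) : R :=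
  (u^T *m v) 0 0.

(* The library norm `|v| on matrices is the sup norm, not the Euclidean one. *)
Definition enorm (R : realType) (d : nat) (v : 'cV[R]_d) : R :=
  Num.sqrt (dotv v v).

Definition spd (R : realType) (d : nat) (H : 'M[R]_d) : Prop :=
  H^T = H /\ forall v : 'cV[R]_d, v != 0 -> 0 < dotv v (H *m v).

Definition objective (R : realType) (d : nat) (H : 'M[R]_d) (q x : 'cV[R]_d) : R :=
  2^-1 * dotv x (H *m x) - dotv q x.

Definition minimizer (R : realType) (d : nat) (H : 'M[R]_d) (q : 'cV[R]_d) : 'cV[R]_d :=
  invmx H *m q.

(* See [is_derive_objective]: this is the gradient of [objective H q]. *)
Definition grad (R : realType) (d : nat) (H : 'M[R]_d) (q x : 'cV[R]_d) : 'cV[R]_d :=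
  H *m (x - minimizer H q).

Definition spec (R : realType) (d : nat) (H : 'M[R]_d) : set R :=
  [set l | eigenvalue H l].

(* [proj_mx] acts on row vectors, and [kermx U^T] is the orthogonal complement
   of the row space of U; the transpose makes the projector act on columns.
   For symmetric H, [eigenproj_sym], [eigenproj_idem] and [eigenproj_range]
   characterize it as the orthogonal projector onto {v | H v = l v}. *)
Definition eigenproj (R : realType) (d : nat) (H : 'M[R]_d) (l : R) : 'M[R]_d :=
  (proj_mx (eigenspace H l) (kermx (eigenspace H l)^T))^T.

Definition active (R : realType) (d : nat) (H : 'M[R]_d) (v : 'cV[R]_d) : set R :=
  [set l | spec H l /\ eigenproj H l *m v != 0].

(* A genuine finite sum, by [finite_spec]. *)
Definition specfun (R : realType) (d : nat) (H : 'M[R]_d) (Psi : R -> R) : 'M[R]_d :=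
  \sum_(l \in spec H) Psi l *: eigenproj H l.

Inductive delayed_rule (R : Type) : Type :=
  | BB1
  | BB2
  | Weighted of (R -> R).
Arguments BB1 {R}.
Arguments BB2 {R}.

(* The step size computed by a rule from the delayed gradient v = g_{k-1}. *)
Definition rule_step (R : realType) (d : nat) (H : 'M[R]_d)
    (rule : delayed_rule R) (v : 'cV[R]_d) : R :=
  match rule with
  | BB1 => dotv v v / dotv v (H *m v)
  | BB2 => dotv v (H *m v) / dotv v (H *m H *m v)
  | Weighted Psi =>
      dotv v (specfun H Psi *m v) / dotv v (specfun H Psi *m H *m v)
  end.

Definition positive_rule (R : realType) (rule : delayed_rule R) (L : set R) : Prop :=
  if rule is Weighted Psi then forall l, L l -> 0 < Psi l else True.

(* Indices are shifted by one: [x n] is x_{n-1}, so [x 0] is x_{-1}, [x 1] is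
   x_0, and alpha_k = [rule_step H rule (grad H q (x k))] is the step from
   x_k = [x k.+1] to x_{k+1} = [x k.+2]. *)
Record post_warmup_tail (R : realType) (d : nat) (H : 'M[R]_d) (q : 'cV[R]_d)
    (rule : delayed_rule R) (x : nat -> 'cV[R]_d) (a b : R) : Prop := {
  tail_warmup : exists alphahat : R, x 1 = x 0 - alphahat *: grad H q (x 0);
  tail_card : (`I_2 #<= active H (grad H q (x 0)))%card;
  tail_min : active H (grad H q (x 0)) a /\ lbound (active H (grad H q (x 0))) a;
  tail_max : active H (grad H q (x 0)) b /\ ubound (active H (grad H q (x 0))) b;
  tail_end : forall j : nat, (j <= 1)%N ->
    eigenproj H a *m grad H q (x j) != 0 /\ eigenproj H b *m grad H q (x j) != 0;
  tail_rule : positive_rule rule (active H (grad H q (x 0)));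
  tail_step : forall k : nat,
    x k.+2 = x k.+1 - rule_step H rule (grad H q (x k)) *: grad H q (x k.+1)
}.

Definition fbar (R : realType) (d : nat) (H : 'M[R]_d) (q : 'cV[R]_d) (a b : R)
    (x : 'cV[R]_d) : R :=
  enorm (eigenproj H a *m grad H q x) `^ (2 * b / (a + b)) *
  enorm (eigenproj H b *m grad H q x) `^ (2 * a / (a + b)).

Definition endrate (R : realType) (a b : R) : R := (b - a) / (b + a).

Definition enddefect (R : realType) (a b u : R) : R :=
  ln (endrate a b) - b / (a + b) * ln ((u - a) / u)
  - a / (a + b) * ln ((b - u) / u).

Lemma dotvDl (R : realType) d (u v w : 'cV[R]_d) :
  dotv (u + v) w = dotv u w + dotv v w.
Proof. by rewrite /dotv linearD /= mulmxDl mxE. Qed.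

Lemma dotvDr (R : realType) d (u v w : 'cV[R]_d) :
  dotv w (u + v) = dotv w u + dotv w v.
Proof. by rewrite /dotv mulmxDr mxE. Qed.

Lemma dotvZl (R : realType) d (c : R) (u w : 'cV[R]_d) :
  dotv (c *: u) w = c * dotv u w.
Proof. by rewrite /dotv linearZ /= -scalemxAl mxE. Qed.

Lemma dotvZr (R : realType) d (c : R) (u w : 'cV[R]_d) :
  dotv w (c *: u) = c * dotv w u.
Proof. by rewrite /dotv -scalemxAr mxE. Qed.

Lemma dotvC (R : realType) d (u v : 'cV[R]_d) : dotv u v = dotv v u.
Proof. by rewrite /dotv !mxE; apply: eq_bigr => i _; rewrite !mxE mulrC. Qed.

Lemma dotv_mul (R : realType) d (M : 'M[R]_d) (u v : 'cV[R]_d) :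
  dotv (M *m u) v = dotv u (M^T *m v).
Proof. by rewrite /dotv trmx_mul mulmxA. Qed.

Lemma dotv_eq0 (R : realType) d (v : 'cV[R]_d) : dotv v v = 0 -> v = 0.
Proof.
rewrite /dotv mxE => /eqP; rewrite psumr_eq0; last first.
  by move=> i _; rewrite !mxE -expr2 sqr_ge0.
move=> /allP h; apply/matrixP => i j; rewrite ord1 mxE.
by have := h i (mem_index_enum i); rewrite /= mxE mulf_eq0 orbb => /eqP.
Qed.

Lemma spd_unit (R : realType) d (H : 'M[R]_d) : spd H -> H \in unitmx.
Proof.
move=> [sH pH]; rewrite -row_free_unit -kermx_eq0; apply/eqP/row_matrixP => i.
rewrite row0; set w := row i _.
have wH : w *m H = 0 by apply/sub_kermxP; exact: row_sub.
apply/eqP/negPn/negP => w0.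
have := pH w^T; rewrite -[in H *m _]sH -trmx_mul wH trmx0 /dotv mulmx0 mxE ltxx.
by move=> /(_ _)/negP; rewrite trmx_eq0 => /(_ w0).
Qed.

Lemma gradE (R : realType) d (H : 'M[R]_d) (q x : 'cV[R]_d) :
  spd H -> grad H q x = H *m x - q.
Proof.
by move=> /spd_unit uH; rewrite /grad /minimizer mulmxBr mulKVmx.
Qed.

Lemma is_derive_objective (R : realType) (d : nat) (H : 'M[R]_d) (q x v : 'cV[R]_d) :
  spd H -> is_derive x v (objective H q) (dotv (grad H q x) v).
Proof.
move=> sH; have cvg : (fun h : R => h^-1 *: ((objective H q \o shift x) (h *: v) -
    objective H q x)) @ 0^' --> dotv (grad H q x) v.
  rewrite -[X in _ --> X](addr0) -[X in _ + X](mul0r (2^-1 * dotv v (H *m v))).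
  apply: cvg_trans; last first.
    apply: (@cvgD _ _ _ (0^' : set_system R) _ (fun=> dotv (grad H q x) v)
      (fun h => h * (2^-1 * dotv v (H *m v)))); first exact: cvg_cst.
    by apply: cvgM; [exact: nbhs_dnbhs|exact: cvg_cst].
  apply: near_eq_cvg; near=> h.
  have h0 : h != 0 by near: h; exact: nbhs_dnbhs_neq.
  have e : dotv x (H *m v) = dotv (H *m x) v by rewrite dotv_mul (proj1 sH).
  rewrite /= /objective gradE // mulmxDr -scalemxAr.
  rewrite !(dotvDl, dotvDr, dotvZl, dotvZr) e -[- q]scaleN1r dotvZl.
  rewrite (dotvC v (H *m x)) /= /GRing.scale /=.
  rewrite -[LHS]/(dotv (H *m x) v + -1 * dotv q v +
    h * (2^-1 * dotv v (H *m v))).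
  by field.
by apply: DeriveDef; [apply/cvg_ex; eexists; exact: cvg | exact: cvg_lim].
Unshelve. all: by end_near. Qed.

Lemma finite_spec (R : realType) (d : nat) (H : 'M[R]_d) : finite_set (spec H).
Proof.
apply: contrapT => /(infinite_set_fset (size (char_poly H))) [B BH].
apply/negP; rewrite -ltnNge; apply: max_poly_roots.
- by rewrite monic_neq0 // char_poly_monic.
- by apply/allP => l lB; rewrite -eigenvalue_root_char; exact: BH.
- exact: fset_uniq.
Qed.

Lemma eigenspaceTP (R : realType) d (H : 'M[R]_d) (l : R) (v : 'cV[R]_d) :
  H^T = H -> (v^T <= eigenspace H l)%MS <-> H *m v = l *: v.
Proof.
move=> sH; split => [/eigenspaceP/(congr1 trmx)|e].
  by rewrite trmx_mul linearZ /= !trmxK sH.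
by apply/eigenspaceP; rewrite -{1}sH -trmx_mul e linearZ.
Qed.

Lemma ortho_cap0 (R : realType) m d (U : 'M[R]_(m, d)) :
  (U :&: kermx U^T = 0)%MS.
Proof.
apply/eqP; rewrite -submx0; apply/rV_subP => w.
rewrite sub_capmx => /andP[/submxP[D wD] /sub_kermxP wU].
rewrite -[w]trmxK (_ : w^T = 0) ?trmx0 ?sub0mx //.
apply: dotv_eq0; rewrite /dotv trmxK {2}wD trmx_mul mulmxA wU mul0mx.
by rewrite mxE.
Qed.

Lemma ortho_sum1 (R : realType) d (U : 'M[R]_d) : (1%:M <= U + kermx U^T)%MS.
Proof.
rewrite sub1mx /row_full mxrank_disjoint_sum ?ortho_cap0 //.
by rewrite mxrank_ker mxrank_tr subnKC // rank_leq_col.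
Qed.

Lemma eigenproj_sym (R : realType) d (H : 'M[R]_d) (l : R) :
  (eigenproj H l)^T = eigenproj H l.
Proof.
rewrite /eigenproj; set U := eigenspace H l; set Q := proj_mx _ _.
have [D QD] : exists D, Q = D *m U.
  by apply/submxP; rewrite -[Q]mul1mx; exact: proj_mx_sub.
have QV : (1%:M - Q) *m U^T = 0.
  by apply/sub_kermxP; rewrite -[Q]mul1mx; apply: proj_mx_compl_sub (ortho_sum1 U).
have UQ : U *m (1%:M - Q)^T = 0.
  by apply: trmx_inj; rewrite trmx_mul trmxK QV trmx0.
have E : Q = Q *m Q^T.
  have : Q *m (1%:M - Q)^T = 0 by rewrite {1}QD -mulmxA UQ mulmx0.
  by rewrite linearB /= trmx1 mulmxBr mulmx1 => /eqP; rewrite subr_eq0 => /eqP.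
by rewrite trmxK; clearbody Q; move: (congr1 trmx E); rewrite trmx_mul trmxK -E.
Qed.

Lemma eigenproj_idem (R : realType) d (H : 'M[R]_d) (l : R) :
  eigenproj H l *m eigenproj H l = eigenproj H l.
Proof.
by rewrite /eigenproj -trmx_mul proj_mx_proj // ortho_cap0.
Qed.

Lemma eigenproj_range (R : realType) d (H : 'M[R]_d) (l : R) (v : 'cV[R]_d) :
  H^T = H -> eigenproj H l *m v = v <-> H *m v = l *: v.
Proof.
move=> sH; rewrite -(eigenspaceTP l v sH) /eigenproj; split => [<-|vU].
  by rewrite trmx_mul trmxK; exact: proj_mx_sub.
by apply: trmx_inj; rewrite trmx_mul trmxK proj_mx_id // ortho_cap0.
Qed.

(* Main.v *)
(** In spectral coordinates every rule gives [tau = 1/alpha] as a Rayleigh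
    quotient of H with weights positive on the active set, hence a weighted mean
    of active eigenvalues in which both endpoints occur, so [a < tau < b].
    A gradient step multiplies the [l]-component of the gradient by
    [(tau - l)/tau]: inactive components stay zero, the endpoint components stay
    nonzero, and the formula for [fbar] follows.  The defect is nonnegative by
    [ln y <= ln c + (y/c - 1)], whose linear parts cancel because
    [b/(a+b) (1 - a/u) + a/(a+b) (b/u - 1) = c]. *)
Require Import Defs.
From mathcomp Require Import all_boot all_order all_algebra.
From mathcomp Require Import all_classical all_reals all_analysis.
From mathcomp Require Import finmap complex spectral mxred ring lra.

Set Implicit Arguments.
Unset Strict Implicit.
Unset Printing Implicit Defensive.

Import Order.TTheory GRing.Theory Num.Theory.
Import numFieldNormedType.Exports.

Local Open Scope classical_set_scope.
Local Open Scope ring_scope.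

(** * Spectral theorem for real symmetric matrices *)

(* Over R[i] the minimal polynomial of H is split with simple real roots, and
   minimal polynomials are invariant under field extension. *)
Lemma sym_diagonalizable (R : rcfType) n (H : 'M[R]_n.+1) :
  H^T = H -> mxred.diagonalizable H.
Proof.
move=> sH; pose f := real_complex R; set HC := map_mx f H.
have hermHC : HC \is hermsymmx.
  apply: realsym_hermsym.
    by apply/is_hermitianmxP; rewrite expr0 scale1r map_mx_id // map_trmx sH.
  by apply/mxOverP => i j; rewrite mxE complex_real.
have uP := spectral_unit HC; have rD := hermitian_spectral_diag_real hermHC.
have /orthomx_spectralP eHC := hermitian_normalmx hermHC.
set P := spectralmx HC in uP eHC; set D := spectral_diag HC in rD eHC.
set rs := undup [seq complex.Re (D 0 i) | i <- enum 'I_n.+1].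
apply/diagonalizableP; exists rs; first exact: undup_uniq.
rewrite -(dvdp_map f) -mxminpoly_map -/HC eHC -conjVmx //.
rewrite mxminpoly_uconj ?unitmx_inv // mxminpoly_diag rmorph_prod /=.
rewrite (eq_bigr (fun r => 'X - (f r)%:P)); last first.
  by move=> r _; rewrite rmorphB /= map_polyX map_polyC.
rewrite -(big_map f predT (fun z => 'X - z%:P)).
rewrite (_ : undup _ = [seq f i | i <- rs]) ?dvdpp //.
rewrite -undup_map_inj; last by move=> ? ? [].
congr undup; rewrite -[RHS]map_comp; apply: eq_map => i /=.
by rewrite /f RRe_real //; apply: (mxOverP rD).
Qed.

(** The spanning form of the spectral theorem, used to resolve the identity; dimension zero is split
    off because [sym_diagonalizable] is stated for [n.+1]. *)
Lemma sym_eigenspaces_full (R : rcfType) n (H : 'M[R]_n) :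
  H^T = H -> exists rs, (1%:M <= \sum_(r <- rs) eigenspace H r)%MS.
Proof.
case: n H => [|n] H sH; first by exists [::]; rewrite thinmx0 sub0mx.
have /diagonalizablePeigen[rs _ rsP] := sym_diagonalizable sH.
by exists rs; rewrite rsP.
Qed.

Lemma mulmx_ext (R : nzSemiRingType) m n (A B : 'M[R]_(m, n)) :
  (forall v : 'cV_n, A *m v = B *m v) -> A = B.
Proof.
move=> AB; apply/matrixP => i j.
by have /matrixP/(_ i 0) := AB (delta_mx j 0); rewrite -!colE !mxE.
Qed.

(** * Spectral calculus and Rayleigh quotients of a symmetric matrix *)

Section EigenProjectors.
Context {R : realType} {d : nat} (H : 'M[R]_d) (sH : H^T = H).

Lemma mulmx_eigenproj l : H *m eigenproj H l = l *: eigenproj H l.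
Proof.
apply: mulmx_ext => v; rewrite -mulmxA -scalemxAl.
by apply/eigenproj_range; rewrite // mulmxA eigenproj_idem.
Qed.

Lemma eigenproj_mulmx l : eigenproj H l *m H = l *: eigenproj H l.
Proof.
apply: trmx_inj.
by rewrite trmx_mul linearZ /= eigenproj_sym sH mulmx_eigenproj.
Qed.

(** Evaluating $P_l H P_m$ from either side gives both $l P_l P_m$ and $m P_l P_m$. *)
Lemma eigenproj_ortho l m : l != m -> eigenproj H l *m eigenproj H m = 0.
Proof.
move=> lm; have /eqP : l *: (eigenproj H l *m eigenproj H m) =
    m *: (eigenproj H l *m eigenproj H m).
  by rewrite scalemxAl -eigenproj_mulmx -mulmxA mulmx_eigenproj -scalemxAr.
by rewrite -subr_eq0 -scalerBl scaler_eq0 subr_eq0 (negPf lm) => /eqP.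
Qed.

Lemma dotv_eigenproj l (v : 'cV_d) :
  dotv v (eigenproj H l *m v) = enorm (eigenproj H l *m v) ^+ 2.
Proof.
rewrite /enorm sqr_sqrtr; last first.
  by rewrite /dotv mxE sumr_ge0 // => i _; rewrite !mxE -expr2 sqr_ge0.
by rewrite dotv_mul eigenproj_sym mulmxA eigenproj_idem.
Qed.

Lemma specfunE Psi :
  specfun H Psi = \sum_(l <- fset_set (spec H)) Psi l *: eigenproj H l.
Proof. by rewrite /specfun fsbig_finite //; exact: finite_spec. Qed.

Lemma mem_fset_spec l : (l \in fset_set (spec H)) = eigenvalue H l.
Proof.
rewrite in_fset_set; last exact: finite_spec.
by apply/idP/idP => [/set_mem|/mem_set].
Qed.

Lemma specfun1 : specfun H (fun=> 1) = 1%:M.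
Proof.
rewrite specfunE; under eq_bigr do rewrite scale1r.
set S := \sum_(l <- _) _; apply/eqP; rewrite eq_sym -subr_eq0 -trmx_eq0 -submx0.
have [rs le1] := sym_eigenspaces_full sH.
(* The eigenspaces span, so it suffices that each one lies in the kernel of $(1-S)^T$. *)
rewrite -[X in (X <= _)%MS]mul1mx.
apply: submx_trans (submxMr _ le1) _.
rewrite submx0 (sameP eqP sub_kermxP).
elim/big_rec: _ => [|r U _ US]; first exact: sub0mx.
rewrite addsmx_sub US andbT; apply/rV_subP => w wr; apply/sub_kermxP.
apply: trmx_inj; rewrite trmx_mul trmxK trmx0 mulmxBl mul1mx.
apply/eqP; rewrite subr_eq0; apply/eqP.
have Pw : eigenproj H r *m w^T = w^T.
  by apply/(eigenproj_range _ _ sH)/eigenspaceTP; rewrite ?trmxK.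
(* The list [rs] may contain non-eigenvalues; their eigenspaces contribute only [w = 0]. *)
have [->|w0] := eqVneq w 0; first by rewrite trmx0 mulmx0.
have rK : r \in fset_set (spec H).
  by rewrite mem_fset_spec; apply/eigenvalueP; exists w => //; exact/eigenspaceP.
rewrite /S (bigD1_seq r) ?fset_uniq //= mulmxDl Pw mulmx_suml big1 ?addr0 //.
move=> l lr; rewrite -Pw mulmxA eigenproj_ortho //.
by rewrite mul0mx.
Qed.

Lemma specfun_mulmx Psi : specfun H Psi *m H = specfun H (fun l => Psi l * l).
Proof.
rewrite !specfunE mulmx_suml; apply: eq_bigr => l _.
by rewrite -scalemxAl eigenproj_mulmx scalerA.
Qed.

Lemma dotv_specfun Psi (v : 'cV_d) : dotv v (specfun H Psi *m v) =
  \sum_(l <- fset_set (spec H)) Psi l * enorm (eigenproj H l *m v) ^+ 2.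
Proof.
rewrite specfunE mulmx_suml /dotv mulmx_sumr summxE; apply: eq_bigr => l _.
by rewrite -scalemxAl -/(dotv _ _) dotvZr dotv_eigenproj.
Qed.

Lemma enorm_gt0 (v : 'cV[R]_d) : v != 0 -> 0 < enorm v.
Proof.
move=> v0; rewrite /enorm sqrtr_gt0 lt0r; apply/andP; split.
  by apply: contra_neq v0 => /dotv_eq0.
by rewrite /dotv mxE sumr_ge0 // => i _; rewrite !mxE -expr2 sqr_ge0.
Qed.

Lemma enormZ c (v : 'cV[R]_d) : enorm (c *: v) = `|c| * enorm v.
Proof.
by rewrite /enorm dotvZl dotvZr mulrA -expr2 sqrtrM ?sqr_ge0 // sqrtr_sqr.
Qed.

(** Terms at inactive eigenvalues vanish, so only the weights on the active set matter. Zero weights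
    are allowed there because the weights [Psi l * (l - a)] and [Psi l * (b - l)] vanish at one
    endpoint. *)
Lemma dotv_specfun_gt0 Psi (v : 'cV_d) m :
    (forall l, active H v l -> 0 <= Psi l) -> active H v m -> 0 < Psi m ->
  0 < dotv v (specfun H Psi *m v).
Proof.
move=> Psi_ge0 [Hm Pm] Psi_m; rewrite dotv_specfun (bigD1_seq m) ?fset_uniq //=.
  apply: ltr_pwDl; first by rewrite mulr_gt0 // exprn_gt0 // enorm_gt0.
  rewrite big_seq_cond sumr_ge0 // => l /andP[]; rewrite mem_fset_spec => Hl _.
  have [->|Pl] := eqVneq (eigenproj H l *m v) 0.
    by rewrite -(scale0r (0 : 'cV[R]_d)) enormZ normr0 mul0r expr0n mulr0.
  by rewrite mulr_ge0 ?Psi_ge0 ?sqr_ge0.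
by rewrite mem_fset_spec.
Qed.

(** With denominators cleared, each gap is a quadratic form with nonnegative weights on the active
    set; the opposite endpoint has positive weight, which makes the bound strict. *)
Lemma weighted_rayleigh_bounds Psi (v : 'cV_d) a b : a < b ->
    active H v a -> active H v b ->
    (forall l, active H v l -> a <= l <= b /\ 0 < Psi l) ->
  a < dotv v (specfun H Psi *m H *m v) / dotv v (specfun H Psi *m v) < b.
Proof.
move=> ab va vb vP.
have D0 : 0 < dotv v (specfun H Psi *m v).
  by apply: (dotv_specfun_gt0 _ va) => [l /vP[_ /ltW]|]; last case: (vP a va).
rewrite ltr_pdivlMr // ltr_pdivrMr //; apply/andP; split; rewrite -subr_gt0.
  have -> : dotv v (specfun H Psi *m H *m v) - a * dotv v (specfun H Psi *m v) =
      dotv v (specfun H (fun l => Psi l * (l - a)) *m v).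
    rewrite specfun_mulmx !dotv_specfun mulr_sumr -sumrB.
    by apply: eq_bigr => l _; ring.
  apply: (dotv_specfun_gt0 _ vb) => [l /vP[/andP[al _] /ltW Pl]|].
    by rewrite mulr_ge0 // subr_ge0.
  by rewrite mulr_gt0 ?subr_gt0 //; case: (vP b vb).
have -> : b * dotv v (specfun H Psi *m v) - dotv v (specfun H Psi *m H *m v) =
    dotv v (specfun H (fun l => Psi l * (b - l)) *m v).
  rewrite specfun_mulmx !dotv_specfun mulr_sumr -sumrB.
  by apply: eq_bigr => l _; ring.
apply: (dotv_specfun_gt0 _ va) => [l /vP[/andP[_ lb] /ltW Pl]|].
  by rewrite mulr_ge0 // subr_ge0.
by rewrite mulr_gt0 ?subr_gt0 //; case: (vP a va).
Qed.

(** BB1 and BB2 are the weighted rules with weights 1 and $\lambda$, so all rules can be treated at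
    once. *)
Definition rule_weight (rule : delayed_rule R) : R -> R :=
  match rule with BB1 => fun=> 1 | BB2 => id | Weighted Psi => Psi end.

Lemma rule_stepE rule (v : 'cV_d) : rule_step H rule v =
  dotv v (specfun H (rule_weight rule) *m v) /
  dotv v (specfun H (rule_weight rule) *m H *m v).
Proof.
case: rule => [||Psi] //=; first by rewrite specfun1 !mul1mx.
have -> : specfun H id = H; last by [].
rewrite -[RHS]mul1mx -specfun1 specfun_mulmx !specfunE.
by apply: eq_bigr => l _; rewrite mul1r.
Qed.

Lemma eigenproj_grad_step q l c (x : 'cV_d) :
  eigenproj H l *m grad H q (x - c *: grad H q x) =
  (1 - c * l) *: (eigenproj H l *m grad H q x).
Proof.
rewrite {1}/grad addrAC mulmxBr -/(grad H q x) mulmxBr -scalemxAr.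
rewrite -scalemxAr mulmxA eigenproj_mulmx -scalemxAl scalerA.
by rewrite scalerBl scale1r.
Qed.

End EigenProjectors.

(** Positive definiteness is tested on the eigenvector $P_l v$, where the form equals $l \|P_l
    v\|^2$. *)
Lemma active_gt0 (R : realType) d (H : 'M[R]_d) v l :
  spd H -> active H v l -> 0 < l.
Proof.
move=> [sH pH] [_ Pl0]; have := pH _ Pl0.
rewrite mulmxA mulmx_eigenproj // -scalemxAl dotvZr pmulr_lgt0 //.
have /(fun h => exprn_gt0 2 h) := enorm_gt0 Pl0.
by rewrite /enorm sqr_sqrtr // ltW // -sqrtr_gt0 enorm_gt0.
Qed.

Lemma rule_weight_gt0 (R : realType) d (H : 'M[R]_d) v (rule : delayed_rule R) l :
    spd H -> positive_rule rule (active H v) -> active H v l ->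
  0 < rule_weight rule l.
Proof.
by case: rule => [||Psi] sH //= rP vl; [exact: active_gt0 vl | exact: rP].
Qed.

(** * The endpoint rate and the defect *)

Lemma endrate_gt0 (R : realType) (a b : R) : 0 < a < b -> 0 < endrate a b.
Proof. by move=> ?; rewrite /endrate divr_gt0; lra. Qed.

Lemma endrate_sqr_lt1 (R : realType) (a b : R) : 0 < a < b -> endrate a b ^+ 2 < 1.
Proof.
move=> ab; rewrite expr_lt1 //; last exact/ltW/endrate_gt0.
by rewrite /endrate ltr_pdivrMr; lra.
Qed.

(** This is Jensen's inequality for [ln]: the weights $b/(a+b)$ and $a/(a+b)$ sum to 1, and the
    weighted mean of the two factors is $c$ for every $u$. Both factors equal $c$ at $u=(a+b)/2$. *)
Lemma enddefect_ge0 (R : realType) (a b u : R) :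
  0 < a -> a < u < b -> 0 <= enddefect a b u.
Proof.
move=> a0 aub; have c0 : 0 < endrate a b by apply: endrate_gt0; lra.
have ln_le (y : R) : 0 < y -> ln y <= ln (endrate a b) + (y / endrate a b - 1).
  move=> y0; rewrite -lerBlDl -ln_div ?posrE //.
  by rewrite -[X in ln X](subrKC 1) le_ln1Dx // ltrBrDl subrr divr_gt0.
have X0 : 0 < (u - a) / u by rewrite divr_gt0; lra.
have Y0 : 0 < (b - u) / u by rewrite divr_gt0; lra.
have w1 : 0 <= b / (a + b) by rewrite divr_ge0; lra.
have w2 : 0 <= a / (a + b) by rewrite divr_ge0; lra.
have := ler_wpM2l w1 (ln_le _ X0); have := ler_wpM2l w2 (ln_le _ Y0).
have E : b / (a + b) * ((u - a) / u / endrate a b - 1) +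
         a / (a + b) * ((b - u) / u / endrate a b - 1) = 0.
  by rewrite /endrate; field; do ?[apply/andP; split]; apply: lt0r_neq0; lra.
have S : a / (a + b) * ln (endrate a b) =
    ln (endrate a b) - b / (a + b) * ln (endrate a b).
  by field; apply: lt0r_neq0; lra.
by rewrite /enddefect !mulrDr S; lra.
Qed.

Lemma powR_enddefect (R : realType) (a b u : R) :
    0 < a -> a < u < b ->
  ((u - a) / u) `^ (2 * b / (a + b)) * ((b - u) / u) `^ (2 * a / (a + b)) =
  endrate a b ^+ 2 * expR (- 2 * enddefect a b u).
Proof.
move=> a0 aub; have c0 : 0 < endrate a b by apply: endrate_gt0; lra.
have X0 : 0 < (u - a) / u by rewrite divr_gt0; lra.
have Y0 : 0 < (b - u) / u by rewrite divr_gt0; lra.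
(* All factors are positive, so both sides become single exponentials, with $c^2$ written as
   $e^{2\log c}$. *)
rewrite /powR !gt_eqF // -[in RHS](lnK c0) -expRM_natl -!expRD.
by congr expR; rewrite /enddefect; ring.
Qed.

(** * Invariants along the tail *)

Lemma tail_endpoints (R : realType) d (H : 'M[R]_d) q rule x a b :
  spd H -> post_warmup_tail H q rule x a b -> 0 < a < b.
Proof.
move=> sH T; have [ga la] := tail_min T; have [gb ub] := tail_max T.
rewrite (active_gt0 sH ga) lt_neqAle la // andbT; apply/eqP => ab.
(* If [a = b], an injection of a two-element set into the active set would take the single value
   [a]. *)
have /pcard_leP/unsquash f := tail_card T.
have fa n : (n < 2)%N -> f n = a.
  move=> n2; have fn : active H (grad H q (x 0)) (f n) by exact: funS.
  by apply/le_anti; rewrite la // andbT ab ub.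
have : {in `I_2 &, injective f} by exact: inj.
have in2 (n : nat) : (n < 2)%N -> n \in `I_2 by move=> ?; exact: mem_set.
by move=> /(_ 0%N 1%N (in2 0%N isT) (in2 1%N isT)); rewrite !fa // => /(_ erefl).
Qed.

(** Stated for any [v] with the required active set, so that it can serve inside the induction that
    establishes these properties for the gradients. *)
Lemma delayed_tau_bounds (R : realType) d (H : 'M[R]_d) q rule x a b v :
    spd H -> post_warmup_tail H q rule x a b ->
    [/\ active H v a, active H v b & active H v `<=` active H (grad H q (x 0))] ->
  a < (rule_step H rule v)^-1 < b.
Proof.
move=> sH T [va vb sv]; have [_ la] := tail_min T; have [_ ub] := tail_max T.
rewrite rule_stepE ?(proj1 sH) // invf_div; apply: weighted_rayleigh_bounds => //.
- exact: proj1 sH.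
- by case/andP: (tail_endpoints sH T).
- move=> l /sv gl; rewrite la ?ub //; split=> //.
  exact: rule_weight_gt0 sH (tail_rule T) gl.
Qed.

Lemma tail_active (R : realType) d (H : 'M[R]_d) q rule x a b :
    spd H -> post_warmup_tail H q rule x a b ->
  forall k, [/\ active H (grad H q (x k)) a, active H (grad H q (x k)) b &
    active H (grad H q (x k)) `<=` active H (grad H q (x 0))].
Proof.
move=> sH T; have [[ga _] _] := tail_min T; have [[gb _] _] := tail_max T.
have sub_step c y : active H (grad H q (y - c *: grad H q y)) `<=`
    active H (grad H q y).
  move=> l [Hl]; rewrite eigenproj_grad_step ?(proj1 sH) // scaler_eq0.
  by rewrite negb_or => /andP[_].
(* The delay makes the recursion two-step: the step from [x k.+1] is computed from the gradient at
   [x k]. Hence two base cases. *)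
elim/ltn_ind => -[_|[_|k IH]].
- by split=> //; [case: (tail_min T)|case: (tail_max T)].
(* The warm-up step is arbitrary and could annihilate an endpoint component, so survival is read off
   the hypothesis on the tail. *)
- have [Pa Pb] := tail_end T (leqnn 1); split=> //.
  by have [c ->] := tail_warmup T; exact: sub_step.
have ak := IH k (leqnSn _); have [a1 b1 s1] := IH k.+1 (leqnn _).
have /andP[ta tb] := delayed_tau_bounds sH T ak.
have a0 : 0 < a by case/andP: (tail_endpoints sH T).
have nz l y : eigenproj H l *m grad H q y != 0 ->
    (rule_step H rule (grad H q (x k)))^-1 != l ->
    eigenproj H l *m grad H q
      (y - rule_step H rule (grad H q (x k)) *: grad H q y) != 0.
  (* A nonzero component is annihilated only if [alpha * l = 1], which forces [tau = l]. *)
  move=> Py; apply: contra_neq; rewrite eigenproj_grad_step ?(proj1 sH) //.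
  move=> /eqP; rewrite scaler_eq0 (negPf Py) orbF subr_eq0 eq_sym => /eqP tl.
  have : rule_step H rule (grad H q (x k)) != 0.
    by apply: contra_eq_neq tl => ->; rewrite mul0r eq_sym oner_eq0.
  by move=> /mulfI; apply; rewrite tl mulfV // -invr_eq0 gt_eqF // (lt_trans a0).
rewrite (tail_step T); split.
- by split=> //; apply: nz; [case: a1|rewrite gt_eqF].
- by split=> //; apply: nz; [case: b1|rewrite lt_eqF].
- exact: subset_trans (sub_step _ _) s1.
Qed.

(** * The recurrence for [fbar] *)

Lemma powR_enormZ (R : realType) d (u v : 'cV[R]_d) s t p r :
  enorm (s *: u) `^ p * enorm (t *: v) `^ r =
  `|s| `^ p * `|t| `^ r * (enorm u `^ p * enorm v `^ r).
Proof. by rewrite !enormZ !powRM ?sqrtr_ge0 // mulrACA. Qed.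

Theorem theorem3p2 (R : realType) (d : nat) (H : 'M[R]_d) (q : 'cV[R]_d)
    (rule : delayed_rule R) (x : nat -> 'cV[R]_d) (a b : R)
    (Hspd : spd H) (Htail : post_warmup_tail H q rule x a b) (k : nat) :
  let alpha := rule_step H rule (grad H q (x k)) in
  let tau := alpha^-1 in
  let F := fbar H q a b in
  let c := endrate a b in
  [/\ a < tau < b,
      F (x k.+2) = ((tau - a) / tau) `^ (2 * b / (a + b)) *
                   ((b - tau) / tau) `^ (2 * a / (a + b)) * F (x k.+1),
      F (x k.+2) = c ^+ 2 * expR (- 2 * enddefect a b tau) * F (x k.+1),
      0 < F (x k.+2) <= c ^+ 2 * F (x k.+1) &
      c ^+ 2 * F (x k.+1) < F (x k.+1)].
Proof.
move=> alpha tau F c.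
have ab := tail_endpoints Hspd Htail; have a0 : 0 < a by lra.
have taub := delayed_tau_bounds Hspd Htail (tail_active Hspd Htail k); rewrite -/alpha -/tau in taub.
have F0 n : 0 < F (x n).
  have [[_ ga] [_ gb] _] := tail_active Hspd Htail n.
  by apply: mulr_gt0; [exact: powR_gt0 (enorm_gt0 ga)|
                      exact: powR_gt0 (enorm_gt0 gb)].
have t0 : 0 < tau by lra.
have FE : F (x k.+2) = ((tau - a) / tau) `^ (2 * b / (a + b)) *
    ((b - tau) / tau) `^ (2 * a / (a + b)) * F (x k.+1).
  have E l : 1 - alpha * l = (tau - l) / tau.
    by rewrite -[alpha]invrK -/tau; field; rewrite gt_eqF.
  have X0 : 0 <= (tau - a) / tau by rewrite divr_ge0; lra.
  have Y0 : 0 <= (b - tau) / tau by rewrite divr_ge0; lra.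
  have S l := eigenproj_grad_step (proj1 Hspd) q l alpha (x k.+1).
  have -> : F (x k.+2) = `|1 - alpha * a| `^ (2 * b / (a + b)) *
      `|1 - alpha * b| `^ (2 * a / (a + b)) * F (x k.+1).
    rewrite {1}/F /fbar (tail_step Htail k).
    apply: etrans (powR_enormZ _ _ _ _ _ _).
    exact: (congr2 (fun u v => enorm u `^ _ * enorm v `^ _) (S a) (S b)).
  (* The factor at [b] is $(\tau-b)/\tau<0$, so its sign is flipped under the absolute value. *)
  by rewrite 2!E (ger0_norm X0) -normrN -mulNr opprB (ger0_norm Y0).
have FE' : F (x k.+2) = c ^+ 2 * expR (- 2 * enddefect a b tau) * F (x k.+1).
  by rewrite FE powR_enddefect.
split=> //.
  rewrite F0 FE' ler_wpM2r ?(ltW (F0 _)) // ler_piMr ?sqr_ge0 // expR_le1.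
  by rewrite mulNr oppr_le0 mulr_ge0 // enddefect_ge0.
by rewrite gtr_pMl // endrate_sqr_lt1.
Qed.
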